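(* For all $m\ge 4$ we have the following, where $n=n(P_{m,2})=3m+1$: (1) $\pi(P_{m,2},u)=n$, (2) $\pi(P_{m,2},v)\le n+5$, and (3) $\pi(P_{m,2},w)\le n+17$.
   Context: A configuration of pebbles on a connected graph $G$ is a function $C:V(G)\to\mathbb{N}$; a pebbling step from a vertex $u$ to a neighbor $v$ removes two pebbles from $u$ and adds one pebble to $v$. For a root $r$, $\pi(G,r)$ is the minimum $t$ such that every configuration of $t$ pebbles can, by a sequence of pebbling steps, place a pebble on $r$; $n(G)$ denotes the number of vertices of $G$. Generalized Petersen-type graphs: for $m\ge 3$ and $d\ge 2$, $P_{m,d}$ has a vertex $u$ and vertices $v_{i,X}$, where $i$ ranges over the $m$ residues modulo $m$ and $X$ is a binary $k$-tuple with $0\le k<d$. Edges: $uv_{i,\emptyset}$ for all $i$; $v_{i,X}v_{i,X^-}$ for all $i$ and nonempty $X$, where $X^-$ is $X$ with its final digit dropped; and for every $i$ and every $X$ of length $d-1$, the edge $v_{i,X}v_{i+1,X}$ (addition modulo $m$), except that when $i=m-1$ one uses instead the edge $v_{m-1,X}v_{0,X^+}$, where $X^+$ is the $(d-1)$-tuple whose binary value is one more than that of $X$. ($P_{3,2}$ is the Petersen graph.) In the theorem, $d=2$, and the roots are $u$, $v=v_{1,\emptyset}$, and $w=v_{1,0}$; by the rotational symmetry of $P_{m,2}$ these three roots cover all cases. *)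

(* Defs.v *)
From mathcomp Require Import all_boot.
From mathcomp Require Import boolp.

Set Implicit Arguments.
Unset Strict Implicit.
Unset Printing Implicit Defensive.

Record connected_graph := ConnectedGraph {
  vertex :> finType;
  adj : rel vertex;
  adj_sym : symmetric adj;
  adj_irr : irreflexive adj;
  adj_connected : forall x y : vertex, connect adj x y }.

Section Pebbling.
Variable G : connected_graph.

Definition config := {ffun G -> nat}.

Definition config_size (C : config) : nat := \sum_x C x.

Definition pebbling_step (C D : config) : Prop :=
  exists x y : G, [/\ adj x y, 2 <= C x &
    D = [ffun z => if z == x then C z - 2
                   else if z == y then C z + 1 else C z]].

Inductive pebbling_steps (C : config) : config -> Prop :=
| pebbling_refl : pebbling_steps C C
| pebbling_rcons (D E : config) :
    pebbling_steps C D -> pebbling_step D E -> pebbling_steps C E.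

Definition solvable (r : G) (C : config) : Prop :=
  exists2 D : config, pebbling_steps C D & 0 < D r.

Lemma pebbling_steps_trans (C D E : config) :
  pebbling_steps C D -> pebbling_steps D E -> pebbling_steps C E.
Proof. by move=> CD; elim=> // D' E' _; apply: pebbling_rcons. Qed.

Lemma pebbling_edge (C : config) (x y : G) (k : nat) :
  adj x y -> k.*2 <= C x -> exists2 D, pebbling_steps C D & k <= D y.
Proof.
move=> xy; elim: k C => [|k IHk] C Ck; first by exists C => //; constructor.
have yNx : (y == x) = false by apply/eqP=> yx; rewrite yx adj_irr in xy.
suff [D [CD Dx Dy]] : exists D : config,
    [/\ pebbling_steps C D, D x = C x - k.+1.*2 & k.+1 <= D y].
  by exists D.
move: (k.+1) Ck => {IHk}k; elim: k => [|k IHk] Ck.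
  by exists C; split=> //; [constructor | rewrite subn0].
have [|D [CD Dx Dy]] := IHk.
  by apply: leq_trans Ck; rewrite leq_double.
have D2 : 2 <= D x by rewrite Dx leq_subRL ?addn2 // -?doubleS // ltnW // ltnW.
exists [ffun z => if z == x then D z - 2
                  else if z == y then D z + 1 else D z]; split.
- by apply: pebbling_rcons CD _; exists x, y.
- by rewrite ffunE eqxx Dx -subnDA addn2.
- by rewrite ffunE yNx eqxx addn1 ltnS.
Qed.

Lemma pebbling_path (C : config) (x : G) (p : seq G) :
  path (@adj G) x p -> 2 ^ size p <= C x -> solvable (last x p) C.
Proof.
elim: p C x => [|y p IHp] C x /=.
  by move=> _ Cx; exists C => //; constructor.
case/andP=> xy yp; rewrite expnS mul2n => /(pebbling_edge xy)[D CD Dy].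
have [E DE Er] := IHp _ _ yp Dy.
by exists E => //; apply: pebbling_steps_trans DE.
Qed.

Lemma all_solvable_exists (r : G) :
  exists t, `[< forall C : config, config_size C = t -> solvable r C >].
Proof.
exists (#|G| * 2 ^ #|G|); apply/asboolP => C Ct.
have [x Cx] : exists x, 2 ^ #|G| <= C x.
  apply/existsP; apply: contra_eqT Ct; rewrite negb_exists => /forallP CG.
  rewrite neq_ltn; apply/orP; left; rewrite /config_size -sum_nat_const.
  rewrite (bigD1 r) //= [X in _ < X](bigD1 r) //= -addSn leq_add //.
    by rewrite ltnNge CG.
  by apply: leq_sum => z _; rewrite ltnW // ltnNge CG.
have /connectP[p xp ->] := adj_connected x r.
case/shortenP: xp => q xq /card_uniqP xqU _; apply: pebbling_path => //.
apply: leq_trans Cx; rewrite leq_pexp2l // ltnW //.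
by rewrite -[(size q).+1]/(size (x :: q)) -xqU max_card.
Qed.

Definition pebbling_number (r : G) : nat := ex_minn (all_solvable_exists r).

End Pebbling.

(* Most significant digit first. *)
Definition binary_value (X : seq bool) : nat :=
  foldl (fun a (b : bool) => a.*2 + b) 0 X.

Section Petersen.
Variables m d : nat.

(* [None] is the centre u; [Some (i, X)] is v_{i,X}, with X of length at most
   d - 1. *)
Definition petersen_vertex : finType :=
  option ('I_m * (d.-1).-bseq bool)%type.

(* Each edge in one orientation. The increment X^+ is taken modulo 2^(d-1), so
   the all-ones tuple is sent to the all-zeros one (for m = 3 and d = 2 this
   closes up the hexagon of the Petersen graph). *)
Definition petersen_arc (x y : petersen_vertex) : bool :=
  match x, y with
  | None, Some (_, X) => X == [::] :> seq bool
  | Some (i, X), Some (j, Y) =>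
      (i == j) && [exists b : bool, X == rcons Y b :> seq bool]
      || [&& size X == d.-1, size Y == d.-1, j == ordS i &
             if i.+1 == m
             then binary_value Y == (binary_value X).+1 %% 2 ^ d.-1
             else Y == X]
  | _, None => false
  end.

Definition petersen_adj (x y : petersen_vertex) : bool :=
  petersen_arc x y || petersen_arc y x.

Lemma petersen_sym : symmetric petersen_adj.
Proof. by move=> x y; rewrite /petersen_adj orbC. Qed.

Lemma petersen_irr : 1 < m -> irreflexive petersen_adj.
Proof.
move=> m_gt1 [[i X]|] //; apply/negbTE; rewrite /petersen_adj orbb /= eqxx /=.
rewrite negb_or; apply/andP; split.
  apply/existsP=> -[b /eqP /(congr1 size)]; rewrite size_rcons => /eqP.
  by rewrite -[_ == _]negbK neq_ltn ltnSn.
suff /negbTE-> : i != ordS i by rewrite !andbF.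
rewrite -val_eqE /=; have := ltn_ord i; rewrite leq_eqVlt => /orP[/eqP im|im].
  by rewrite im modnn; apply: contraTneq m_gt1 => i0; rewrite -im i0.
by rewrite modn_small // neq_ltn ltnSn.
Qed.

Lemma petersen_connected (x y : petersen_vertex) : connect petersen_adj x y.
Proof.
suff to_u z : connect petersen_adj z None.
  by apply: (connect_trans (to_u x)); rewrite (sym_connect_sym petersen_sym).
case: z => [[i [X Xd]]|]; last exact: connect0.
elim/last_ind: X Xd => [|X b IHX] Xd.
  exact: connect1.
have Xd' : size X <= d.-1.
  by rewrite size_rcons in Xd; apply: ltnW.
apply: connect_trans (IHX Xd'); apply: connect1.
rewrite /petersen_adj /= eqxx /=; apply/orP; left; apply/orP; left.
by apply/existsP; exists b.
Qed.

End Petersen.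

Definition petersen (m d : nat) (hm : 3 <= m) (hd : 2 <= d) : connected_graph :=
  ConnectedGraph (@petersen_sym m d) (petersen_irr (ltnW hm))
    (@petersen_connected m d).

Section Roots.
Variables (m : nat) (hm : 3 <= m).

Definition petersen_m2 : connected_graph := petersen hm (leqnn 2).

Let i1 : 'I_m := Ordinal (ltnW hm).

Definition root_u : petersen_m2 := None.
Definition root_v : petersen_m2 := Some (i1, [bseq]).
Definition root_w : petersen_m2 := Some (i1, [bseq false]).

End Roots.

(* Main.v *)
(** Call a weight function [w] on the vertices a strategy for the root [r] if
    every vertex of positive weight other than [r] has a neighbour which is
    [r] or has at least twice its weight. If a configuration weighs more than
    the sum of all the weights off [r], then some vertex of positive weight
    carries two pebbles; moving them along does not decrease the weight of the
    configuration but removes a pebble, so iterating this must reach [r].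
    Summing several strategies whose total is at least [c] everywhere off [r]
    then bounds the pebbling number.

    For the hub, use one strategy per spoke vertex: 4 on it, 2 on its two rim
    neighbours and 1 on their rim neighbours; the total is 4 everywhere. For
    the two other roots, use the same three strategies, one per residue class
    modulo 3 of spokes: 16 on the root's spoke vertex, 8 on the hub, 4 on the
    spoke vertices of the class, 2 on their rim neighbours and 1 on the other
    rim vertices. The total is 4, with an excess of 44 on the root's spoke
    vertex, 20 on the hub and at most 1 on the two rim vertices of that
    spoke. *)

Require Import Defs.
From mathcomp Require Import all_boot.
From mathcomp Require Import boolp zify.

Set Implicit Arguments.
Unset Strict Implicit.
Unset Printing Implicit Defensive.

Lemma sum_eq_neq (T : finType) (a r : T) :
  \sum_(x | x != r) (x == a) = (a != r).
Proof.
have [->|ar] := eqVneq a r; first by rewrite big1 // => x /negPf->.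
by rewrite (bigD1 a) //= eqxx big1 // => x /andP[_ /negPf->].
Qed.

(** * Weight strategies and general bounds on the pebbling number *)

Section Weights.
Variables (G : connected_graph) (r : G).

(** The disjunct [y == r] leaves the weight at the root free, so that one function can be a strategy
    for two different roots. *)
Definition weight_strategy (w : G -> nat) := forall x, x != r -> 0 < w x ->
  exists2 y, adj x y & (y == r) || ((w x).*2 <= w y).

Lemma weight_function (w : G -> nat) (C : config G) :
    weight_strategy w -> ~ solvable r C ->
  \sum_(x | x != r) w x * C x <= \sum_(x | x != r) w x.
Proof.
move=> ws; have [k] := ubnP (config_size C).
elim: k C => // k IHk C Ck nC; rewrite leqNgt; apply/negP => ltwC.
have [x xr ltx] : exists2 x, x != r & w x < w x * C x.
  apply/exists_inP; apply: contraTT ltwC => /exists_inPn le.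
  by rewrite -leqNgt; apply: leq_sum => x /le; rewrite -leqNgt.
have [wx Cx] : 0 < w x /\ 2 <= C x by split; nia.
have [y xy wy] := ws x xr wx.
have yx : y != x by apply: contraTneq xy => ->; rewrite adj_irr.
pose D : config G := [ffun z => if z == x then C z - 2
                   else if z == y then C z + 1 else C z].
have CD : pebbling_step C D by exists x, y.
have Dx : D x = C x - 2 by rewrite ffunE eqxx.
have Dy : D y = C y + 1 by rewrite ffunE (negPf yx) eqxx.
have Dz z : z != x -> z != y -> D z = C z.
  by rewrite ffunE => /negPf-> /negPf->.
have CDs : pebbling_steps C D by apply: pebbling_rcons CD; constructor.
have nD : ~ solvable r D.
  by case=> E DE Er; apply: nC; exists E => //; apply: pebbling_steps_trans DE.
have [yr|yr] := eqVneq y r.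
  by apply: nD; exists D; [constructor | rewrite -yr Dy addn1].
rewrite (negPf yr) /= in wy.
have ltDk : config_size D < k.
  rewrite -ltnS; apply: leq_trans Ck; rewrite ltnS /config_size.
  rewrite (bigD1 x) //= (bigD1 y) //= [X in _ < X](bigD1 x) //=.
  rewrite [X in _ < _ + X](bigD1 y) //= Dx Dy.
  rewrite (eq_bigr C) => [|z /andP[zx zy]]; last exact: Dz.
  by move: (C x) (C y) (\sum_(_ | _) _) Cx; lia.
have := IHk D ltDk nD; apply/negP; rewrite -ltnNge; apply: leq_trans ltwC _.
rewrite (bigD1 x) //= (bigD1 y) ?yr ?yx //= [X in _ <= X](bigD1 x) //=.
rewrite [X in _ <= _ + X](bigD1 y) ?yr ?yx //= Dx Dy.
rewrite [X in _ <= _ + (_ + X)](eq_bigr (fun z => w z * C z)) => [|z].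
  by move: (C x) (C y) (\sum_(_ | _) _) Cx wy; nia.
by move=> /andP[/andP[_ zx] zy]; rewrite Dz.
Qed.

Lemma pebbling_number_le t :
  (forall C : config G, config_size C = t -> solvable r C) ->
  pebbling_number r <= t.
Proof.
move=> solt; rewrite /pebbling_number; case: ex_minnP => k _ kmin.
exact/kmin/asboolP.
Qed.

Lemma pebbling_number_weights (I : finType) (w : I -> G -> nat) c t :
    (forall i, weight_strategy (w i)) ->
    (forall x, x != r -> c <= \sum_i w i x) ->
    \sum_(x | x != r) \sum_i w i x < c * t ->
  pebbling_number r <= t.
Proof.
move=> ws wc lt_t; apply: pebbling_number_le => C Ct.
have [//|nC] := pselect (solvable r C).
have Cr : C r = 0.
  apply/eqP; rewrite -leqn0 leqNgt; apply/negP => Cr.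
  by apply: nC; exists C => //; constructor.
suff: c * t <= \sum_(x | x != r) \sum_i w i x by lia.
rewrite -Ct /config_size (bigD1 r) //= Cr add0n big_distrr /=.
rewrite exchange_big /=.
apply: leq_trans (leq_sum _ (fun i _ => weight_function (ws i) nC)).
rewrite exchange_big /=; apply: leq_sum => x xr.
by rewrite -big_distrl /= leq_mul2r wc ?orbT.
Qed.

(** With fewer than [#|G|] pebbles, put at most one on each vertex and none on [r]: no step is
    possible. *)
Lemma card_le_pebbling_number : #|G| <= pebbling_number r.
Proof.
rewrite /pebbling_number; case: ex_minnP => t /asboolP solt _.
rewrite leqNgt; apply/negP => lt_tG.
pose s := take t (enum [set~ r]).
have us : uniq s by rewrite take_uniq ?enum_uniq.
have st : size s = t.
  by rewrite size_takel // -cardE cardsC1; lia.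
pose C : config G := [ffun x => (x \in s) : nat].
have Ct : config_size C = t.
  rewrite -st -(card_uniqP us) -sum1_card /config_size [RHS]big_mkcond /=.
  by apply: eq_bigr => x _; rewrite ffunE; case: (x \in s).
have [D CD Dr] := solt C Ct.
have DC : D = C.
  elim: CD => // D' E _ -> [x [y [_]]]; rewrite ffunE.
  by case: (x \in s).
by move: Dr; rewrite DC ffunE lt0b => /mem_take; rewrite mem_enum !inE eqxx.
Qed.

End Weights.

(** * Vertices and edges of the graph for d = 2 *)

Section PetersenWeights.
Variables (m : nat) (hm : 4 <= m).
Let P := petersen_m2 (ltnW hm).

Definition spoke (i : 'I_m) : P := Some (i, [bseq]).
Definition rim (i : 'I_m) (b : bool) : P := Some (i, [bseq b]).

Variant petersen_spec : P -> Type :=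
| PetersenHub : petersen_spec None
| PetersenSpoke i : petersen_spec (spoke i)
| PetersenRim i b : petersen_spec (rim i b).

Lemma petersenP x : petersen_spec x.
Proof.
case: x => [[i [[|b [|b' s]] Xs]]|].
- have -> : Bseq Xs = [bseq] by exact: val_inj.
  exact: PetersenSpoke.
- have -> : Bseq Xs = [bseq b] by exact: val_inj.
  exact: PetersenRim.
- by [].
exact: PetersenHub.
Qed.

(** The weight of a rim vertex ignores its digit, so the twist where the rim closes up does not
    matter. *)
Definition petersen_weight (h : nat) (s t : 'I_m -> nat) (x : P) : nat :=
  if x is Some (i, X) then if size X == 0 then s i else t i else h.

Lemma sum_petersen (F : P -> nat) :
  \sum_x F x = F None + \sum_i F (spoke i) + \sum_i \sum_b F (rim i b).
Proof.
pose f (y : unit + 'I_m + 'I_m * bool) : P :=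
  match y with inl (inl _) => None | inl (inr i) => spoke i
             | inr (i, b) => rim i b end.
pose g (x : P) : unit + 'I_m + 'I_m * bool :=
  match x with
  | None => inl (inl tt)
  | Some (i, X) => if val X is b :: _ then inr (i, b) else inl (inr i)
  end.
have fK : cancel f g by case=> [[[]|i]|[i b]].
have gK : cancel g f by move=> x; case: (petersenP x).
rewrite (reindex f) /=; last by exists g => y _; [exact: fK | exact: gK].
rewrite !big_sumType /= sum_nat_const card_unit mul1n pair_bigA /=.
by congr (_ + _); apply: eq_bigr => -[].
Qed.

Lemma card_petersen : #|P| = 3 * m + 1.
Proof.
rewrite -sum1_card sum_petersen.
under [X in _ + X]eq_bigr do rewrite sum_nat_const card_bool.
rewrite !sum_nat_const card_ord; lia.
Qed.

Lemma adj_hub_spoke i : adj (None : P) (spoke i).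
Proof. by []. Qed.

Lemma adj_spoke_rim i b : adj (spoke i) (rim i b).
Proof.
rewrite /= /petersen_adj /= eqxx /=.
apply/orP; right; apply/orP; left.
by apply/existsP; exists b.
Qed.

(** The digit flips only between the indices m - 1 and 0. It is left existential because the weights
    do not see it. *)
Lemma adj_rim_next i b : exists b', adj (rim i b) (rim (ordS i) b').
Proof.
exists (if i.+1 == m then ~~ b else b).
rewrite /= /petersen_adj /= eqxx /=.
apply/orP; left; apply/orP; right.
by case: (_ == m); case: b.
Qed.

Lemma adj_rim_prev i b : exists b', adj (rim i b) (rim (ord_pred i) b').
Proof.
exists (if (ord_pred i).+1 == m then ~~ b else b).
rewrite adj_sym /= /petersen_adj /= ord_predK eqxx /=.
apply/orP; left; apply/orP; right.
by case: (_ == m); case: b.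
Qed.

Lemma val_ordS (i : 'I_m) : ordS i = (if i.+1 == m then 0 else i.+1) :> nat.
Proof.
have := ltn_ord i; rewrite leq_eqVlt /=.
by case: eqP => [->|_ /= im]; rewrite ?modnn ?modn_small.
Qed.

Lemma ordS_neq (i : 'I_m) : ordS i != i.
Proof.
by apply/eqP => /(congr1 (@nat_of_ord m)); rewrite val_ordS; case: eqP; lia.
Qed.

(** Ensures that the two neighbouring positions of [i] differ; otherwise the two weights 1 of a hub
    strategy would add up to 2. *)
Lemma ordSS_neq (i : 'I_m) : ordS (ordS i) != i.
Proof.
apply/eqP => /(congr1 (@nat_of_ord m)); rewrite !val_ordS.
by do 2!case: eqP; lia.
Qed.

(** * The hub as root *)

Lemma pebbling_number_hub : pebbling_number (root_u (ltnW hm)) = #|P|.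
Proof.
apply/eqP; rewrite eqn_leq card_le_pebbling_number andbT.
pose w (i : 'I_m) := petersen_weight 0 (fun j => 4 * (j == i))
  (fun j => 2 * (j == i) + (j == ordS i) + (ordS j == i)).
have sw x : x != root_u (ltnW hm) -> \sum_i w i x = 4.
  case: (petersenP x) => [|j|j b] // _.
    rewrite /w /= -big_distrr /= (bigD1 j) //= eqxx big1 // => i.
    by rewrite eq_sym => /negPf->.
  (* A rim vertex at [j] gets 2 from strategy [j] and 1 from each of the strategies [ord_pred j] and
     [ordS j]. *)
  rewrite /w /= 2!big_split -big_distrr /=.
  rewrite (bigD1 j) //= eqxx big1 => [|i]; last by rewrite eq_sym => /negPf->.
  rewrite (bigD1 (ord_pred j)) //= ord_predK eqxx big1 => [|i ij]; last first.
    by rewrite -[j in j == _]ord_predK (inj_eq (@ordS_inj _)) eq_sym (negPf ij).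
  rewrite (bigD1 (ordS j)) //= eqxx big1 // => i.
  by rewrite eq_sym => /negPf->.
apply: (@pebbling_number_weights _ _ _ w 4) => [i x xr wx|x /sw->//|];
  last first.
  (* Off the hub the weights sum to 4 * 3m, which is less than 4n. *)
  rewrite (eq_bigr _ sw) sum_nat_const mulnC ltn_pmul2l //.
  by rewrite (cardC1 (root_u (ltnW hm))) card_petersen addn1.
case: (petersenP x) xr wx => [|j|j b] // _ wj.
  by exists (root_u (ltnW hm)); rewrite ?eqxx.
have [ji|ji] := eqVneq j i.
  exists (spoke i); first by rewrite adj_sym ji adj_spoke_rim.
  by rewrite /w /= ji eqxx eq_sym !(negPf (ordS_neq i)).
rewrite /w /= (negPf ji) muln0 add0n in wj.
have [jSi|jSi] := eqVneq j (ordS i).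
  have [b' jb'] := adj_rim_prev j b; exists (rim (ord_pred j) b') => //.
  rewrite /w /= jSi ordSK !eqxx [i == _]eq_sym.
  by rewrite !(negPf (ordS_neq _)) (negPf (ordSS_neq _)).
rewrite (negPf jSi) add0n lt0b in wj; rewrite -(eqP wj) in jSi ji *.
have [b' jb'] := adj_rim_next j b; exists (rim (ordS j) b') => //.
by rewrite /w /= (negPf ji) (negPf jSi) eqxx.
Qed.

(** * The other two roots *)

(* Positions are counted from the roots, which have first coordinate 1; the
   position 0 also serves as m, the neighbour of the position m - 1. *)
Definition heavy (c p : nat) : bool :=
  (p %% 3 == c) || (p == 0) && (m %% 3 == c).

Definition class_weight (c : 'I_3) : P -> nat :=
  petersen_weight 8
    (fun i => if ord_pred i == 0 :> nat then 16 else 4 * heavy c (ord_pred i))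
    (fun i => 1 + heavy c (ord_pred i)).

Lemma class_weight_rim c i b :
  class_weight c (rim i b) = 1 + heavy c (ord_pred i).
Proof. by []. Qed.

Lemma class_weight_spoke c i : class_weight c (spoke i) =
  if ord_pred i == 0 :> nat then 16 else 4 * heavy c (ord_pred i).
Proof. by []. Qed.

(** Three consecutive integers meet every class modulo 3, and reading 0 as m makes the neighbourhood
    of m - 1 consecutive too. Position 0 would need both readings at once; its rim vertices use the
    root's spoke vertex instead. *)
Lemma heavy_near (c : 'I_3) (i : 'I_m) :
  i != 0 :> nat -> [|| heavy c i, heavy c (ordS i) | heavy c (ord_pred i)].
Proof.
have := val_ordS (ord_pred i); rewrite ord_predK val_ordS /heavy.
have := ltn_ord (ord_pred i); have := ltn_ord c; have := ltn_ord i.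
move: (nat_of_ord (ord_pred i)) (nat_of_ord i) (nat_of_ord c) => p k c'.
by case: (eqVneq p.+1 m); case: (eqVneq k.+1 m); lia.
Qed.

Lemma class_weight_step (c : 'I_3) (x : P) :
  x != root_v (ltnW hm) -> 0 < class_weight c x ->
  exists2 y, adj x y & (class_weight c x).*2 <= class_weight c y.
Proof.
have pv : ord_pred (Ordinal (ltnW (ltnW hm))) = 0 :> nat by rewrite /= modnn.
case: (petersenP x) => [|i|i b] xv wx.
- by exists (root_v (ltnW hm)) => //=; rewrite modnn.
- exists None; first by rewrite adj_sym adj_hub_spoke.
  have pi : ord_pred i != 0 :> nat.
    apply: contraNneq xv => pi; apply/eqP; congr (spoke _).
    by apply: ord_pred_inj; apply: val_inj; exact: etrans pi (esym pv).
  by rewrite class_weight_spoke (negPf pi); case: heavy.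
case: (boolP ((ord_pred i == 0 :> nat) || heavy c (ord_pred i))).
  move=> hi; exists (spoke i); first by rewrite adj_sym adj_spoke_rim.
  move: hi; rewrite class_weight_rim class_weight_spoke.
  by case: eqP; case: heavy.
rewrite negb_or => /andP[pi /negPf hi].
have := heavy_near c pi; rewrite hi ord_predK /= => /orP[h|h].
  have [b' ib'] := adj_rim_next i b; exists (rim (ordS i) b') => //.
  by rewrite !class_weight_rim ordSK hi h.
have [b' ib'] := adj_rim_prev i b; exists (rim (ord_pred i) b') => //.
by rewrite !class_weight_rim hi h.
Qed.

Lemma sum_class_weight_ge x : 4 <= \sum_(c < 3) class_weight c x.
Proof.
rewrite !big_ord_recr big_ord0.
case: (petersenP x) => [|i|i b] //.
  rewrite !class_weight_spoke /heavy; case: eqP => // _.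
  by move: (nat_of_ord (ord_pred i)) => p /=; lia.
rewrite !class_weight_rim /heavy.
by move: (nat_of_ord (ord_pred i)) => p /=; lia.
Qed.

Let rv : P := root_v (ltnW hm).
Let rw : P := root_w (ltnW hm).
Let rw' : P := rim (Ordinal (ltnW (ltnW hm))) true.

(** The three strategies give the hub 3 * 8 = 4 + 20 and the root's spoke vertex 3 * 16 = 4 + 44.
    Position 0, also read as m, is heavy in two classes unless 3 divides m, whence the extra 1 on
    its rim vertices. *)
Lemma sum_class_weight_le x : \sum_(c < 3) class_weight c x <=
  4 + 20 * (x == None) + 44 * (x == rv) + (x == rw) + (x == rw').
Proof.
have pi i : (i == Ordinal (ltnW (ltnW hm))) = (ord_pred i == 0 :> nat).
  rewrite -(inj_eq (@ord_pred_inj _)) -(inj_eq val_inj).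
  by rewrite [val (ord_pred (Ordinal _))]modnn.
rewrite !big_ord_recr big_ord0.
case: (petersenP x) => [|i|i b] //.
  rewrite !class_weight_spoke /heavy.
  rewrite (_ : (spoke i == rv) = (ord_pred i == 0 :> nat)).
    by move: (nat_of_ord (ord_pred i)) => p /=; case: eqP; lia.
  by rewrite -pi; apply/eqP/eqP => [[->]|->] //; apply: val_inj.
have rE b' : (rim i b == rim (Ordinal (ltnW (ltnW hm))) b') =
    (ord_pred i == 0 :> nat) && (b == b').
  by rewrite -pi; apply/eqP/andP => [[/eqP ? ->]|[/eqP-> /eqP->]].
rewrite !class_weight_rim /heavy !rE.
by move: (nat_of_ord (ord_pred i)) => p /=; case: b {rE}; lia.
Qed.

Lemma sum_class_weight_neq r :
  \sum_(x | x != r) \sum_(c < 3) class_weight c x <=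
  4 * (3 * m) + 20 * (None != r) + 44 * (rv != r) + (rw != r) + (rw' != r).
Proof.
apply: leq_trans (leq_sum _ (fun x _ => sum_class_weight_le x)) _.
rewrite 4!big_split -!big_distrr /= !sum_eq_neq sum_nat_const.
by rewrite (cardC1 r) card_petersen addn1 mulnC.
Qed.

Lemma pebbling_number_spoke : pebbling_number rv <= #|P| + 5.
Proof.
apply: (@pebbling_number_weights _ _ _ class_weight 4) => [c x xv wx|x _|].
- have [y xy wy] := class_weight_step xv wx.
  by exists y; rewrite ?wy ?orbT.
- exact: sum_class_weight_ge.
(* The total is at most 12m + 20 + 1 + 1, below 4(n + 5) = 12m + 24. *)
apply: leq_ltn_trans (sum_class_weight_neq _) _.
by rewrite eqxx card_petersen /=; lia.
Qed.

Lemma pebbling_number_rim : pebbling_number rw <= #|P| + 17.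
Proof.
apply: (@pebbling_number_weights _ _ _ class_weight 4) => [c x xw wx|x _|].
(* The vertex [rv], no longer the root, pebbles its neighbour [rw] directly. *)
- have [->|xv] := eqVneq x rv.
    by exists rw; rewrite ?eqxx //; apply: adj_spoke_rim.
  have [y xy wy] := class_weight_step xv wx.
  by exists y; rewrite ?wy ?orbT.
- exact: sum_class_weight_ge.
(* The excess at [rv] now counts: at most 12m + 20 + 44 + 1, below 4(n + 17) = 12m + 72. *)
apply: leq_ltn_trans (sum_class_weight_neq _) _.
by rewrite eqxx card_petersen /=; lia.
Qed.

End PetersenWeights.

Theorem theorem3p10 (m : nat) (hm : 4 <= m) :
  let n := #|petersen_m2 (ltnW hm)| in
  [/\ n = 3 * m + 1,
      pebbling_number (root_u (ltnW hm)) = n,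
      pebbling_number (root_v (ltnW hm)) <= n + 5
    & pebbling_number (root_w (ltnW hm)) <= n + 17].
Proof.
split.
- exact: card_petersen.
- exact: pebbling_number_hub.
- exact: pebbling_number_spoke.
exact: pebbling_number_rim.
Qed.
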